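(* The symmetric group $S_n$ is minimal wexp-nonsolvable if and only if $n = 5$ or $n \ge 7$.
   Context: Let $G$ be a finite group. A subgroup $H \le G$ is called weakly exponential with respect to $G$ if, for all $x \in G$, there exists $g \in G$ such that $x^{|G:H|} \in H^g$, where $H^g = g^{-1}Hg$. The group $G$ is called wexp-solvable if every subgroup of $G$ is weakly exponential with respect to $G$, and wexp-nonsolvable if it is not wexp-solvable. The group $G$ is called minimal wexp-nonsolvable if $G$ is wexp-nonsolvable but all proper quotients of $G$ (quotients by nontrivial normal subgroups) are wexp-solvable. *)

(* Defs.v *)
From mathcomp Require Import all_boot all_fingroup.
Set Implicit Arguments.
Unset Strict Implicit.
Unset Printing Implicit Defensive.

Local Open Scope group_scope.

Definition weakly_exponential (gT : finGroupType) (G H : {group gT}) : Prop :=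
  forall x, x \in G -> exists2 g, g \in G & x ^+ #|G : H| \in H :^ g.

Definition wexp_solvable (gT : finGroupType) (G : {group gT}) : Prop :=
  forall H : {group gT}, H \subset G -> weakly_exponential G H.

Definition minimal_wexp_nonsolvable (gT : finGroupType) (G : {group gT}) : Prop :=
  ~ wexp_solvable G /\
  forall N : {group gT}, N <| G -> N :!=: 1 -> wexp_solvable (G / N)%G.

(* Main.v *)
Require Import Defs.
From mathcomp Require Import all_boot all_fingroup.
From mathcomp Require Import all_solvable zify.

(** The failure of weak exponentiality comes from point stabilisers.  A point
stabiliser of S_n has index n, so it contains no conjugate of s ^+ n as soon
as s ^+ n moves every point, that is, as soon as no cycle length of s divides
n.  If n = a + b with a, b > 1 coprime, a permutation with one a-cycle and one
b-cycle has this property: if a divides a + b then a divides b.  Such a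
decomposition exists exactly for n = 5 and n >= 7 ([coprime_partition],
[two_cycles_free], [Sym_wexp_nonsolvable]).  For these n every nontrivial
normal subgroup of S_n contains A_n, so the proper quotients of S_n are
abelian, hence wexp-solvable.

Conversely, S_n is wexp-solvable for n <= 4 and for n = 6
([Sym_wexp_solvable]).  In any finite group, an element x of prime power order
satisfies the condition for every H: by Sylow's theorem one may work inside a
p-group, where all subgroups are subnormal, and x ^+ #|G : H| lies in every
subnormal subgroup H of G.  By taking p-constituents, it is even enough that
x ^+ #|G : H| has prime power order ([expg_index_p_elt]).  In S_n, two coprime
prime powers that divide the order of a permutation have sum at most n
([two_prime_powers_dvd_order]), so a bad power can only occur for n >= 5.  For
n = 6 it forces the index of H to be coprime to 6, hence to divide 5; index 1
is trivial, and S_6 has no subgroup of index 5 because S_6 does not embed into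
S_5 ([Sym6_index_neq5]). *)

Set Implicit Arguments.
Unset Strict Implicit.
Unset Printing Implicit Defensive.

Local Open Scope group_scope.

(** * Powers by the index of a subgroup *)

Lemma expg_index_normal (gT : finGroupType) (G H : {group gT}) x :
  H <| G -> x \in G -> x ^+ #|G : H| \in H.
Proof.
case/andP=> sHG nHG Gx; have Nx := subsetP nHG x Gx.
rewrite coset_idr ?groupX // morphX // -card_quotient //.
by apply/eqP; rewrite -order_dvdn order_dvdG ?mem_quotient.
Qed.

Lemma expg_index_subnormal (gT : finGroupType) (G H : {group gT}) x :
  H <|<| G -> x \in G -> x ^+ #|G : H| \in H.
Proof.
case/subnormalP=> s; elim: s H => [|K s IHs] H /= Hs defG Gx.
  by rewrite defG indexgg expg1.
case/andP: Hs => nsHK Ks.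
have sKG: K \subset G by apply/subnormal_sub/subnormalP; exists s.
rewrite -(Lagrange_index sKG (normal_sub nsHK)) expgM.
by apply: expg_index_normal => //; apply: IHs.
Qed.

Lemma abelian_wexp_solvable (gT : finGroupType) (G : {group gT}) :
  abelian G -> wexp_solvable G.
Proof.
move=> cGG H sHG x Gx; exists 1; rewrite ?group1 ?conjsg1 //.
by apply: expg_index_normal => //; rewrite -sub_abelian_normal.
Qed.

(** A Sylow p-subgroup Q of H sits in a Sylow p-subgroup P of G that contains a
conjugate of x.  Since P is nilpotent, Q is subnormal in P, and #|P : Q| is the
p-part of #|G : H|. *)
Lemma p_elt_expg_index (gT : finGroupType) (p : nat) (G H : {group gT}) x :
    H \subset G -> x \in G -> p.-elt x ->
  exists2 g, g \in G & x ^+ #|G : H| \in H :^ g.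
Proof.
move=> sHG Gx px.
have [Q sylQ] := Sylow_exists p H.
have [sQH pQ _] := and3P sylQ.
have [P sylP sQP] := Sylow_superset (subset_trans sQH sHG) pQ.
have [sPG pP _] := and3P sylP.
have [g Gg sxP] : exists2 g, g \in G & <[x]> :^ g \subset P.
  by apply: (Sylow_Jsub sylP); rewrite ?cycle_subG.
have Pxg: x ^ g \in P by rewrite (subsetP sxP) // memJ_conjg cycle_id.
exists g^-1; rewrite ?groupV // mem_conjgV conjXg.
have dvPQ: #|P : Q| %| #|G : H|.
  rewrite -divgS // (card_Hall sylP) (card_Hall sylQ).
  rewrite -(Lagrange sHG) partnM // mulKn ?part_gt0 //.
  exact: dvdn_part.
rewrite (subsetP sQH) // -(divnK dvPQ) mulnC expgM groupX //.
apply: expg_index_subnormal => //.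
exact: nilpotent_subnormal (pgroup_nil pP) sQP.
Qed.

(** Only the power has to be a p-element: it is then equal to the same power of
the p-constituent of x, to which the previous lemma applies. *)
Lemma expg_index_p_elt (gT : finGroupType) (p : nat) (G H : {group gT}) x :
    H \subset G -> x \in G -> p.-elt (x ^+ #|G : H|) ->
  exists2 g, g \in G & x ^+ #|G : H| \in H :^ g.
Proof.
move=> sHG Gx px; rewrite -(constt_p_elt px) consttX.
apply: (p_elt_expg_index (p := p)) => //; last exact: p_elt_constt.
by rewrite /constt groupX.
Qed.

Lemma p_elt_or_two_primes (gT : finGroupType) (y : gT) :
  (exists p : nat, p.-elt y) \/
  exists p q : nat, [/\ p < q, p \in \pi(#[y]) & q \in \pi(#[y])].
Proof.
have [->|nty] := eqVneq y 1; first by left; exists 2; apply: p_elt1.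
set p := pdiv #[y].
have piP: p \in \pi(#[y]) by rewrite pi_pdiv order_gt1.
have [py|] := boolP (p.-elt y); first by left; exists p.
rewrite /p_elt /pnat order_gt0 /= -has_predC => /hasP[q piq /= neqp].
right; case: (ltngtP p q) => [ltpq|ltqp|eqpq].
- by exists p, q.
- by exists q, p.
by rewrite inE /= eqpq eqxx in neqp.
Qed.

(** * Orders of permutations *)

Lemma porbit_dvd_order (T : finType) (s : {perm T}) i : #|porbit s i| %| #[s].
Proof. by rewrite porbit.unlock; apply: dvdn_orbit. Qed.

Lemma porbit_dvd_fix (T : finType) (s : {perm T}) i m :
  #|porbit s i| %| m -> (s ^+ m) i = i.
Proof.
case/dvdnP=> k ->; rewrite mulnC expgM; apply: permX_fix.
by rewrite permX iter_porbit.
Qed.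

(** The order of s is the least common multiple of its cycle lengths: if no
cycle length were divisible by p ^ k.+1, then s ^+ (#[s] %/ p) would fix every
point. *)
Lemma prime_power_dvd_porbit (T : finType) (s : {perm T}) p k :
  prime p -> p ^ k.+1 %| #[s] -> exists i, p ^ k.+1 %| #|porbit s i|.
Proof.
move=> prp dvs; have pN: p %| #[s] by apply: dvdn_trans dvs; rewrite dvdn_exp.
apply/existsP; apply: contraT => /existsPn no_i.
suff: #[s] %| #[s] %/ p.
  move/dvdn_leq; rewrite divn_gt0 ?prime_gt0 // (dvdn_leq _ pN) //.
  by move/(_ isT); rewrite leqNgt ltn_Pdiv ?prime_gt1.
rewrite order_dvdn; apply/eqP/permP=> i; rewrite perm1 porbit_dvd_fix //.
have := porbit_dvd_order s i; have /negP := no_i i.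
have c_gt0 : 0 < #|porbit s i| by rewrite (cardD1 i) porbit_id.
move: #|_| c_gt0 => c c_gt0; rewrite pfactor_dvdn // => /negP.
rewrite -leqNgt => cle dvc.
apply/dvdn_partP=> // q; rewrite mem_primes => /and3P[prq _ _].
rewrite p_part pfactor_dvdn ?divn_gt0 ?prime_gt0 ?(dvdn_leq _ pN) //.
rewrite logn_div // (logn_prime q prp).
have [->|_] := eqVneq q p; last by rewrite subn0 dvdn_leq_log.
by apply: leq_trans cle _; rewrite leq_subRL ?add1n -?pfactor_dvdn // -logn_gt0.
Qed.

(** Each prime power divides a cycle length.  If one cycle serves for both, its
length is a multiple of their product, which is at least their sum; otherwise the
two cycles are disjoint. *)
Lemma two_prime_powers_dvd_order (T : finType) (s : {perm T}) p a q b :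
    prime p -> prime q -> p != q -> p ^ a.+1 %| #[s] -> q ^ b.+1 %| #[s] ->
  p ^ a.+1 + q ^ b.+1 <= #|T|.
Proof.
move=> prp prq neqpq /(prime_power_dvd_porbit prp)[i pi].
case/(prime_power_dvd_porbit prq)=> j qj.
have cpq: coprime (p ^ a.+1) (q ^ b.+1).
  by rewrite coprimeXl ?coprimeXr // prime_coprime // dvdn_prime2.
have p_gt1: 1 < p ^ a.+1 by rewrite -(exp1n a.+1) ltn_exp2r ?prime_gt1.
have q_gt1: 1 < q ^ b.+1 by rewrite -(exp1n b.+1) ltn_exp2r ?prime_gt1.
have c_gt0 k : 0 < #|porbit s k| by rewrite (cardD1 k) porbit_id.
have [eqij|neqij] := eqVneq (porbit s i) (porbit s j).
  have: p ^ a.+1 * q ^ b.+1 %| #|porbit s i| by rewrite Gauss_dvd // pi eqij.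
  move/(dvdn_leq (c_gt0 i))=> le_i.
  apply: leq_trans (leq_trans le_i (max_card _)).
  case: (p ^ _)%N p_gt1 => [|[|u]] // _; case: (q ^ _)%N q_gt1 => [|[|v]] // _.
  by rewrite mulnSr mulSn; lia.
apply: leq_trans (leq_add (dvdn_leq (c_gt0 i) pi) (dvdn_leq (c_gt0 j) qj)) _.
rewrite -cardsUI.
suff ->: porbit s i :&: porbit s j = set0 by rewrite cards0 addn0 max_card.
apply/eqP/set0Pn=> -[k /setIP[]]; rewrite -!eq_porbit_mem => /eqP-> /eqP eqj.
by rewrite eqj eqxx in neqij.
Qed.

(** * Normal subgroups of symmetric groups *)

(** The core is the kernel of the action on right cosets, so G embeds into the
symmetric group on these cosets. *)
Lemma leq_card_core_free (gT : finGroupType) (G H : {group gT}) :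
  gcore H G = 1 -> #|G| <= #|G : H|`!.
Proof.
move=> core1.
have nS: [acts G, on rcosets H G | 'Rs].
  exact: atrans_acts (transRs_rcosets H G).
have nSG: actby_cond G (rcosets H G) 'Rs by [].
have ffG: [faithful G, on rcosets H G | 'Rs].
  by rewrite /faithful astabRs_rcosets core1 subsetIr.
have := faithful_isom nSG ffG => /isom_isog isoG.
rewrite (card_isog (isoG _)) // -card_perm subset_leq_card //.
apply/subsetP=> _ /morphimP[g _ Gg ->]; rewrite unfold_in; apply/subsetP=> A.
rewrite inE /= actpermE /=; apply: contraR => notA.
by rewrite /actby (negPf notA).
Qed.

(** As A_n is simple, N either contains it or meets it trivially.  The latter is
impossible: commutators are even, so N would be central, while the element s of
N that moves i does not commute with the transposition of s i and a third
point. *)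
Lemma Alt_sub_normal (T : finType) (N : {group {perm T}}) :
  4 < #|T| -> N <| [set: {perm T}] -> N :!=: 1 -> 'Alt_T \subset N.
Proof.
move=> T_gt4 nsN /trivgPn[s Ns nts].
have [_ simA] := simpleP _ (simple_Alt5 T_gt4).
have nsNA: N :&: 'Alt_T <| 'Alt_T.
  by rewrite setIC; apply: normalGI nsN; apply: subsetT.
have [NA1|<-] := simA _ nsNA; last exact: subsetIl.
have [i neqi]: exists i, s i != i.
  apply/existsP; apply: contraR nts => /existsPn ids; apply/eqP/permP=> i.
  by rewrite perm1; apply/eqP; rewrite -[_ == _]negbK ids.
have [k Ck]: exists k, k \notin [set i; s i].
  have: 0 < #|~: [set i; s i]|.
    rewrite cardsCs setCK subn_gt0 cards2 (leq_ltn_trans _ T_gt4) // ltnS.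
    by case: eqP.
  by case/card_gt0P=> k; rewrite inE; exists k.
move: Ck; rewrite !inE negb_or => /andP[neqki neqks].
pose t := tperm (s i) k.
have: [~ s, t] \in N :&: 'Alt_T.
  rewrite inE Alt_even commgEl odd_permM odd_permJ odd_permV addbb andbT.
  by rewrite groupM ?groupV // memJ_norm // (subsetP (normal_norm nsN)) ?inE.
rewrite NA1 => /set1gP/eqP/commgP/permP/(_ i); rewrite !permM tpermL tpermD //.
by move/eqP; rewrite (negPf neqks).
Qed.

Lemma Sym_quotient_wexp_solvable (T : finType) (N : {group {perm T}}) :
    4 < #|T| -> N <| [set: {perm T}] -> N :!=: 1 ->
  wexp_solvable ([set: {perm T}] / N)%G.
Proof.
move=> T_gt4 nsN ntN; apply: abelian_wexp_solvable.
apply: sub_der1_abelian; apply: subset_trans (Alt_sub_normal T_gt4 nsN ntN).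
rewrite gen_subG; apply/subsetP=> _ /imset2P[s t _ _ ->].
by rewrite Alt_even commgEl odd_permM odd_permJ odd_permV addbb.
Qed.

(** The core of such a subgroup would be trivial, giving 6! <= 5!, or contain
A_6, giving an index that divides 2. *)
Lemma Sym6_index_neq5 (T : finType) (H : {group {perm T}}) :
  #|T| = 6 -> #|[set: {perm T}] : H| <> 5.
Proof.
move=> T6 iH5.
have nsK: gcore H [set: {perm T}] <| [set: {perm T}].
  by rewrite gcore_normal ?subsetT.
have [K1|ntK] := eqVneq (gcore H [set: {perm T}]) 1.
  by have := leq_card_core_free K1; rewrite iH5 (card_Sym T) T6.
have sAH: 'Alt_T \subset H.
  by apply: subset_trans (Alt_sub_normal _ nsK ntK) (gcore_sub _ _); rewrite T6.
have: #|[set: {perm T}] : H| %| #|[set: {perm T}] : 'Alt_T| by rewrite indexgS.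
by rewrite iH5 (Alt_index (T := T)) ?T6.
Qed.

(** * Symmetric groups of degree at most 6 *)

(** If the power y = x ^+ m by the index m is not a p-element, two primes divide
the order of x; their sum is at most 6, so they are 2 and 3, and the degree is
at least 5, hence 6.  Were m divisible by r = 2 or 3, the order of x would be
divisible by r ^ 2 and by the other prime, and 4 + 3 and 2 + 9 both exceed 6.
So m is a divisor of 6! coprime to 6, that is, 1 or 5. *)
Lemma Sym_wexp_solvable (T : finType) :
  #|T| <= 6 -> #|T| != 5 -> wexp_solvable [set: {perm T}]%G.
Proof.
move=> T_le6 T_neq5 H sHG x Gx; set G := [set: _]%G in sHG Gx *.
set m := #|G : H|; set y := x ^+ m.
have [[p py]|[p [q [ltpq piy qiy]]]] := p_elt_or_two_primes y.
  exact: expg_index_p_elt py.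
have [prp prq]: prime p /\ prime q.
  by split; [move: piy | move: qiy]; rewrite mem_primes => /andP[].
have pdvy: p %| #[y] by move: piy; rewrite mem_primes => /and3P[].
have qdvy: q %| #[y] by move: qiy; rewrite mem_primes => /and3P[].
have neqpq: p != q by rewrite neq_ltn ltpq.
have pdvx := dvdn_trans pdvy (orderXdvd x m).
have qdvx := dvdn_trans qdvy (orderXdvd x m).
have lepqT : p + q <= #|T|.
  exact: (@two_prime_powers_dvd_order _ x p 0 q 0).
(* The order of y is #[x] divided by gcdn #[x] m, so a prime dividing both #[y]
and m divides #[x] twice. *)
have r2dvx r : prime r -> r %| #[y] -> r %| m -> r ^ 2 %| #[x].
  move=> prr rdvy rdvm; rewrite -(divnK (dvdn_gcdl #[x] m)) -orderXgcd expnS expn1.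
  by rewrite dvdn_mul // dvdn_gcd rdvm (dvdn_trans rdvy) ?orderXdvd.
have p2 : p = 2.
  by case: p prp ltpq lepqT {piy pdvy neqpq pdvx} => [|[|[|[|p]]]] // *; lia.
have q3 : q = 3.
  by subst p; case: q prq ltpq lepqT {qiy qdvy neqpq qdvx} => [|[|[|[|[|q]]]]] // *; lia.
subst p q; have T6 : #|T| = 6.
  by apply/eqP; rewrite eqn_leq T_le6 ltn_neqAle eq_sym T_neq5.
have m2 : ~~ (2 %| m).
  apply/negP=> /(r2dvx 2 prp pdvy) d.
  by have := @two_prime_powers_dvd_order _ x 2 1 3 0 prp prq neqpq d qdvx; rewrite T6.
have m3 : ~~ (3 %| m).
  apply/negP=> /(r2dvx 3 prq qdvy) d.
  by have := @two_prime_powers_dvd_order _ x 2 0 3 1 prp prq neqpq pdvx d; rewrite T6.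
have: m %| 5.
  have: m %| 2 ^ 4 * (3 ^ 2 * 5).
    by have := dvdn_indexg G H; rewrite (card_Sym T) T6.
  by rewrite !Gauss_dvdr ?coprimeXr // coprime_sym prime_coprime.
rewrite dvdn_divisors // !inE => /orP[m1|/eqP m5].
  exists 1; rewrite ?group1 // conjsg1 /y (eqP m1) expg1.
  have /subsetP sGH: G \subset H by rewrite -indexg_eq1 -/m (eqP m1).
  exact: sGH.
by have := @Sym6_index_neq5 T H T6 m5.
Qed.

(** * Point stabilisers and permutations with two cycles *)

Lemma index_Sym_stab (T : finType) (i : T) :
  #|[set: {perm T}] : 'C_[set: {perm T}][i | 'P]| = #|T|.
Proof.
rewrite -card_orbit; apply: eq_card => j; rewrite inE.
by apply/orbitP; exists (tperm i j); rewrite ?inE //= apermE tpermL.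
Qed.

(** A conjugate of the stabiliser of i is the stabiliser of another point, and
s ^+ #|T| lies in no point stabiliser. *)
Lemma Sym_wexp_nonsolvable (T : finType) (i : T) (s : {perm T}) :
  (forall j, (s ^+ #|T|) j != j) -> ~ wexp_solvable [set: {perm T}]%G.
Proof.
move=> s_free solvT; pose H := 'C_[set: {perm T}][i | 'P]%G.
have [g _] := solvT H (subsetT _) s (in_setT _).
rewrite /= (index_Sym_stab i) mem_conjg => /setIP[_ /astab1P /=].
rewrite apermE !permM invgK => /(canRL (permKV _)) fixg.
by have := s_free (g i); rewrite fixg eqxx.
Qed.

(** The permutation rotates the first a points and the last b points; a fixed
point of its (a + b)-th power in the first block would make a divide b, and one
in the second block would make b divide a. *)
Lemma two_cycles_free (a b : nat) : 1 < a -> 1 < b -> coprime a b ->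
  exists s : 'S_(a + b), forall j, (s ^+ (a + b)) j != j.
Proof.
move=> a_gt1 b_gt1 cab.
have a_gt0 := ltnW a_gt1; have b_gt0 := ltnW b_gt1.
(* r k is the k-th iterate of the rotation of both blocks. *)
pose r (k i : nat) :=
  (if i < a then (i + k) %% a else a + (i - a + k) %% b)%N.
have r_lt k (i : 'I_(a + b)) : r k i < a + b.
  rewrite /r; case: ifP => _; last by rewrite ltn_add2l ltn_pmod.
  by rewrite (leq_trans (ltn_pmod _ a_gt0)) ?leq_addr.
have rD k l i : r l (r k i) = r (k + l) i.
  rewrite /r; case: (ltnP i a) => _; first by rewrite ltn_pmod // modnDml addnA.
  by rewrite ltnNge leq_addr /= addKn modnDml addnA.
pose f k i := Ordinal (r_lt k i).
have f_inj : injective (f 1%N).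
  have fK : cancel (f 1%N) (f (a * b)%N.-1).
    move=> i; apply: val_inj; rewrite /= rD add1n prednK ?muln_gt0 ?a_gt0 //.
    rewrite /r; case: ltnP => [ia|ai]; first by rewrite mulnC addnC modnMDl modn_small.
    by rewrite [(_ + a * b)%N]addnC modnMDl modn_small ?subnKC // ltn_subLR.
  exact: can_inj fK.
exists (perm f_inj) => j.
have powE k : val ((perm f_inj ^+ k) j) = r k j.
  elim: k => [|k IHk]; last by rewrite expgSr permM permE /= IHk rD addn1.
  rewrite expg0 perm1 /r; case: ltnP => [ja|aj]; rewrite addn0 modn_small ?subnKC //.
  by rewrite ltn_subLR.
apply/eqP=> /(congr1 val); rewrite powE /= /r; case: ltnP => [ja|aj] /eqP.
  rewrite -{2}(modn_small ja) -{2}[val j]addn0 eqn_modDl mod0n -/(dvdn _ _).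
  rewrite dvdn_addr // => /gcdn_idPl; rewrite (eqP cab) => a1.
  by rewrite -a1 in a_gt1.
rewrite -{2}(subnKC aj) eqn_add2l.
rewrite -{2}(@modn_small (j - a) b) ?ltn_subLR //.
rewrite -{2}[(j - a)%N]addn0 eqn_modDl mod0n -/(dvdn _ _).
rewrite dvdn_addl // => /gcdn_idPr; rewrite (eqP cab) => b1.
by rewrite -b1 in b_gt1.
Qed.

(** Odd n splits as 2 + (n - 2).  Even n = 2k splits symmetrically around k into
two odd numbers at distance 2 or 4, according to the parity of k; distance 4
needs k - 2 > 1, which is where n = 6 fails. *)
Lemma coprime_partition n : n = 5 \/ 7 <= n ->
  exists a b, [/\ 1 < a, 1 < b, coprime a b & n = a + b].
Proof.
move=> n57.
have [n_odd|n_even] := boolP (odd n).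
  exists 2, (n - 2); split; try lia.
  by rewrite coprime2n oddB; lia.
pose k := n./2; have def_n: n = k.*2 by rewrite -[LHS]odd_double_half (negPf n_even).
have [k_odd|k_even] := boolP (odd k).
  exists (k - 2), (k - 2 + 2 ^ 2); split; try lia.
  by rewrite /coprime gcdnDl -/(coprime _ _) coprime_pexpr // coprimen2; lia.
exists (k - 1), (k - 1 + 2); split; try lia.
by rewrite /coprime gcdnDl -/(coprime _ _) coprimen2; lia.
Qed.

Theorem theorem1p10 (n : nat) :
  minimal_wexp_nonsolvable [set: 'S_n]%G <-> (n = 5 \/ 7 <= n).
Proof.
split=> [[nsolv _]|n57].
  have [n_le6|] := leqP n 6; last by right.
  have [->|n_neq5] := eqVneq n 5; first by left.
  by case: nsolv; apply: Sym_wexp_solvable; rewrite card_ord.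
split; last first.
  by move=> N; apply: Sym_quotient_wexp_solvable; rewrite card_ord; lia.
have [a [b [a_gt1 b_gt1 cab def_n]]] := coprime_partition n57.
have [s s_free] := two_cycles_free a_gt1 b_gt1 cab.
rewrite {}def_n {n n57}; have ab_gt0 : 0 < a + b by lia.
by apply: (Sym_wexp_nonsolvable (Ordinal ab_gt0) (s := s)); rewrite card_ord.
Qed.
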